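(* Let $\mathfrak{g}$ be a Lie algebra, $\sigma:\mathfrak{g}\times\mathfrak{g}\to\mathfrak{n}$ a Lie algebra 2-cocycle, $\widehat{\mathfrak{g}}=\mathfrak{g}\oplus\mathfrak{n}$ the corresponding central extension, and $\widehat{\mathfrak{g}}\ltimes\widehat{\mathfrak{g}}$ its self-semidirect product. Then for $((\xi_h,\alpha),(\xi_k,\beta))\in\widehat{\mathfrak{g}}\ltimes\widehat{\mathfrak{g}}$ and $((m,l),(n,o))$ in the dual space, the coadjoint operator is $$\operatorname{ad}^*_{((\xi_h,\alpha),(\xi_k,\beta))}((m,l),(n,o))=\Big(\big(\operatorname{ad}^*_{\xi_h}m+\sigma^*(\xi_h,l)+\operatorname{ad}^*_{\xi_k}n+\sigma^*(\xi_k,o),\,0\big),\ \big(\operatorname{ad}^*_{\xi_h+\xi_k}n+\sigma^*(\xi_h+\xi_k,o),\,0\big)\Big).$$ Consequently the Euler–Poincaré equations on $\widehat{\mathfrak{g}}\ltimes\widehat{\mathfrak{g}}$ are $$\frac{dm}{dt}=-\operatorname{ad}^*_{\xi_h}m-\sigma^*(\xi_h,l)-\operatorname{ad}^*_{\xi_k}n-\sigma^*(\xi_k,o),\qquad \frac{dl}{dt}=0,$$ $$\frac{dn}{dt}=-\operatorname{ad}^*_{\xi_h+\xi_k}n-\sigma^*(\xi_h+\xi_k,o),\qquad \frac{do}{dt}=0.$$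
   Context: Write $\operatorname{ad}_\xi\eta=[\xi,\eta]$. $\mathfrak{n}$ is an abelian Lie algebra (the center direction). A Lie algebra 2-cocycle is a skew-symmetric (continuous) bilinear map $\sigma:\mathfrak{g}\times\mathfrak{g}\to\mathfrak{n}$ with $\sigma(u,[v,w])+\sigma(v,[w,u])+\sigma(w,[u,v])=0$ for all $u,v,w\in\mathfrak{g}$. The central extension $\widehat{\mathfrak{g}}=\mathfrak{g}\oplus\mathfrak{n}$ has bracket $\operatorname{ad}_{(\xi,\alpha)}(\eta,\beta)=([\xi,\eta],\sigma(\xi,\eta))$. For a Lie algebra $\mathfrak{a}$, the self-semidirect product $\mathfrak{a}\ltimes\mathfrak{a}$ is $\mathfrak{a}\times\mathfrak{a}$ with bracket $$\operatorname{ad}_{(X,Y)}(Z,W)=\big(\operatorname{ad}_X Z,\ \operatorname{ad}_{X+Y}(Z+W)-\operatorname{ad}_X Z\big)$$ (this is the Lie algebra of the semidirect product of a Lie group with itself, acting by conjugation). Duals are taken with respect to nondegenerate pairings, and pairings on products are the sums of componentwise pairings: $\langle (m,l),(\xi,\alpha)\rangle=\langle m,\xi\rangle+\langle l,\alpha\rangle$ on $\widehat{\mathfrak{g}}$, and $\langle (M,N),(X,Y)\rangle=\langle M,X\rangle+\langle N,Y\rangle$ on $\widehat{\mathfrak{g}}\ltimes\widehat{\mathfrak{g}}$. The coadjoint operator is defined by $\langle\operatorname{ad}^*_\xi\mu,\eta\rangle=\langle\mu,\operatorname{ad}_\xi\eta\rangle$, and $\sigma^*:\mathfrak{g}\times\mathfrak{n}^*\to\mathfrak{g}^*$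 is defined by $\langle\sigma^*(\xi,l),\eta\rangle=\langle l,\sigma(\xi,\eta)\rangle$; $\operatorname{ad}^*$ on $\mathfrak{g}^*$ and $\sigma^*$ are assumed to exist (automatic in finite dimensions). The Euler–Poincaré equation on a Lie algebra $\mathfrak{a}$ with Lagrangian $\ell:\mathfrak{a}\to\mathbb{R}$ is $\frac{d}{dt}\mu+\operatorname{ad}^*_{\zeta}\mu=0$ for a differentiable curve $\zeta(t)\in\mathfrak{a}$, with momentum $\mu=\frac{\delta\ell}{\delta\zeta}\in\mathfrak{a}^*$. Here $\zeta=((\xi_h,\alpha),(\xi_k,\beta))$ and $\mu=((m,l),(n,o))$. *)

(* Defs.v *)
From HB Require Import structures.
From mathcomp Require Import all_boot all_order all_algebra.
From mathcomp Require Import all_classical all_reals all_analysis.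

Set Implicit Arguments.
Unset Strict Implicit.
Unset Printing Implicit Defensive.

Import Order.TTheory GRing.Theory Num.Theory.
Import numFieldNormedType.Exports.

Local Open Scope classical_set_scope.
Local Open Scope ring_scope.

Lemma prod_ext (A B : Type) (x y : A * B) : x.1 = y.1 -> x.2 = y.2 -> x = y.
Proof. by case: x y => [? ?] [? ?] /= -> ->. Qed.

HB.mixin Record isLieAlgebra (R : nzRingType) V & GRing.Lmodule R V := {
  ad : V -> V -> V;
  ad_bilinear : bilinear_for *:%R *:%R ad;
  ad_alt : forall x, ad x x = 0;
  ad_jacobi : forall x y z, ad x (ad y z) + ad y (ad z x) + ad z (ad x y) = 0
}.

#[short(type="lieAlgType")]
HB.structure Definition LieAlgebra (R : nzRingType) :=
  {V of isLieAlgebra R V & GRing.Lmodule R V}.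

(* The topology serves to differentiate curves and to state continuity of
   cocycles; no compatibility with the bracket is assumed.  Hausdorffness is not
   required, so an abstract Lie algebra (indiscrete topology) is an instance,
   as are finite-dimensional and Frechet Lie algebras. *)
#[short(type="tvsLieAlgType")]
HB.structure Definition TvsLieAlgebra (R : realType) :=
  {V of LieAlgebra R V & Tvs R V}.

Section LieTheory.
Context (R : nzRingType) (V : lieAlgType R).
Implicit Types x y z : V.

Lemma adDl x y z : ad (x + y) z = ad x z + ad y z.
Proof. by have /= := ad_bilinear.1 z 1 x y; rewrite !scale1r. Qed.

Lemma adDr x y z : ad z (x + y) = ad z x + ad z y.
Proof. by have /= := ad_bilinear.2 z 1 x y; rewrite !scale1r. Qed.

Lemma ad0l z : ad (0 : V) z = 0.
Proof. by apply: (@addrI _ (ad 0 z)); rewrite -adDl !addr0. Qed.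

Lemma ad0r z : ad z (0 : V) = 0.
Proof. by apply: (@addrI _ (ad z 0)); rewrite -adDr !addr0. Qed.

Lemma adZl a x z : ad (a *: x) z = a *: ad x z.
Proof. by have /= := ad_bilinear.1 z a x 0; rewrite ad0l !addr0. Qed.

Lemma adZr a x z : ad z (a *: x) = a *: ad z x.
Proof. by have /= := ad_bilinear.2 z a x 0; rewrite ad0r !addr0. Qed.

End LieTheory.

Section Cocycle.
Context (R : realType).

(* [n] stands for an abelian Lie algebra, i.e. a vector space. *)
Record lie_cocycle (g : tvsLieAlgType R) (n : tvsType R) := LieCocycle {
  cocycle_fun :> {bilinear g -> g -> n};
  cocycle_skew : forall u v, cocycle_fun u v = - cocycle_fun v u;
  cocycle_continuous : continuous (fun p : g * g => cocycle_fun p.1 p.2);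
  cocycle_closed : forall u v w,
    cocycle_fun u (ad v w) + cocycle_fun v (ad w u) +
      cocycle_fun w (ad u v) = 0
}.

Lemma cocycle_alt (g : tvsLieAlgType R) (n : tvsType R)
  (sigma : lie_cocycle g n) u : sigma u u = 0.
Proof.
have /eqP := cocycle_skew sigma u u.
by rewrite -addr_eq0 -mulr2n -scaler_nat scaler_eq0 pnatr_eq0 /= => /eqP.
Qed.

Definition central_ext (g : tvsLieAlgType R) (n : tvsType R)
  (sigma : lie_cocycle g n) : Type := (g * n)%type.

End Cocycle.

Section CentralExtension.
Context (R : realType) (g : tvsLieAlgType R) (n : tvsType R).
Context (sigma : lie_cocycle g n).

HB.instance Definition _ := Tvs.copy (central_ext sigma) (g * n)%type.

Definition central_ad (x y : central_ext sigma) : central_ext sigma :=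
  (ad x.1 y.1, sigma x.1 y.1).

Lemma central_ad_bilinear : bilinear_for *:%R *:%R central_ad.
Proof.
split=> z a x y; apply: prod_ext => /=.
- by rewrite adDl adZl.
- by rewrite linearDl linearZl_LR.
- by rewrite adDr adZr.
- by rewrite linearDr linearZr_LR.
Qed.

Lemma central_ad_alt x : central_ad x x = 0.
Proof. by rewrite /central_ad ad_alt cocycle_alt. Qed.

Lemma central_ad_jacobi x y z :
  central_ad x (central_ad y z) + central_ad y (central_ad z x) +
    central_ad z (central_ad x y) = 0.
Proof.
apply: prod_ext => /=; first exact: ad_jacobi.
exact: cocycle_closed.
Qed.

HB.instance Definition _ := isLieAlgebra.Build R (central_ext sigma)
  central_ad_bilinear central_ad_alt central_ad_jacobi.

End CentralExtension.

Definition self_semidirect (R : realType) (a : tvsLieAlgType R) : Type :=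
  (a * a)%type.

Section SelfSemidirect.
Context (R : realType) (a : tvsLieAlgType R).

HB.instance Definition _ := Tvs.copy (self_semidirect a) (a * a)%type.

Definition semidirect_ad (x y : self_semidirect a) : self_semidirect a :=
  (ad x.1 y.1, ad (x.1 + x.2) (y.1 + y.2) - ad x.1 y.1).

Lemma semidirect_ad_bilinear : bilinear_for *:%R *:%R semidirect_ad.
Proof.
split=> -[z1 z2] k [x1 x2] [y1 y2]; apply: prod_ext => /=.
- by rewrite adDl adZl.
- rewrite addrACA -scalerDr.
  move: (x1 + x2) (y1 + y2) (z1 + z2) => u v w.
  by rewrite !adDl !adZl scalerBr opprD addrACA.
- by rewrite adDr adZr.
- rewrite addrACA -scalerDr.
  move: (x1 + x2) (y1 + y2) (z1 + z2) => u v w.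
  by rewrite !adDr !adZr scalerBr opprD addrACA.
Qed.

Lemma semidirect_ad_alt x : semidirect_ad x x = 0.
Proof. by rewrite /semidirect_ad !ad_alt subrr. Qed.

Lemma semidirect_ad_jacobi x y z :
  semidirect_ad x (semidirect_ad y z) + semidirect_ad y (semidirect_ad z x) +
    semidirect_ad z (semidirect_ad x y) = 0.
Proof.
apply: prod_ext => /=; first exact: ad_jacobi.
have addBK (u v : a) : u + (v - u) = v by rewrite addrC subrK.
have sumB3 (u1 u2 u3 v1 v2 v3 : a) :
    u1 - v1 + (u2 - v2) + (u3 - v3) = u1 + u2 + u3 - (v1 + v2 + v3).
  by rewrite (addrACA u1) (addrACA (u1 + u2)) -!opprD.
by rewrite !addBK sumB3 !ad_jacobi subr0.
Qed.

HB.instance Definition _ := isLieAlgebra.Build R (self_semidirect a)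
  semidirect_ad_bilinear semidirect_ad_alt semidirect_ad_jacobi.

End SelfSemidirect.

(* A space [D] serving as a dual of [V]. *)
Record dual_pairing (R : realType) (V D : lmodType R) := DualPairing {
  pairing_fun :> {bilinear D -> V -> R | *%R & *%R};
  pairing_nondegl : forall mu, (forall eta, pairing_fun mu eta = 0) -> mu = 0;
  pairing_nondegr : forall eta, (forall mu, pairing_fun mu eta = 0) -> eta = 0
}.

Section ProdPairing.
Context (R : realType) (V W D E : lmodType R).
Context (p : dual_pairing V D) (q : dual_pairing W E).

Definition prod_pairing_fun (mu : D * E) (x : V * W) : R :=
  p mu.1 x.1 + q mu.2 x.2.

Lemma prod_pairing_bilinear : bilinear_for *%R *%R prod_pairing_fun.
Proof.
split=> z k x y; rewrite /prod_pairing_fun /= mulrDr.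
- by rewrite !linearDl !linearZl_LR addrACA.
- by rewrite !linearDr !linearZr_LR addrACA.
Qed.

HB.instance Definition _ :=
  bilinear_isBilinear.Build R (D * E)%type (V * W)%type R *%R *%R
    prod_pairing_fun prod_pairing_bilinear.

Lemma prod_pairing_nondegl mu :
  (forall eta, prod_pairing_fun mu eta = 0) -> mu = 0.
Proof.
case: mu => mu nu h; apply: prod_ext => /=.
- apply: (pairing_nondegl (d := p)) => eta.
  by have := h (eta, 0); rewrite /prod_pairing_fun /= linear0r addr0.
- apply: (pairing_nondegl (d := q)) => eta.
  by have := h (0, eta); rewrite /prod_pairing_fun /= linear0r add0r.
Qed.

Lemma prod_pairing_nondegr eta :
  (forall mu, prod_pairing_fun mu eta = 0) -> eta = 0.
Proof.
case: eta => x y h; apply: prod_ext => /=.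
- apply: (pairing_nondegr (d := p)) => mu.
  by have := h (mu, 0); rewrite /prod_pairing_fun /= linear0l addr0.
- apply: (pairing_nondegr (d := q)) => mu.
  by have := h (0, mu); rewrite /prod_pairing_fun /= linear0l add0r.
Qed.

Definition prod_pairing : dual_pairing (V * W)%type (D * E)%type :=
  DualPairing prod_pairing_nondegl prod_pairing_nondegr.

End ProdPairing.

Definition central_pairing (R : realType) (g : tvsLieAlgType R) (n : tvsType R)
    (sigma : lie_cocycle g n) (gs ns : lmodType R)
    (pg : dual_pairing g gs) (pn : dual_pairing n ns) :
    dual_pairing (central_ext sigma) (gs * ns)%type :=
  prod_pairing pg pn.

Definition semidirect_pairing (R : realType) (a : tvsLieAlgType R)
    (D : lmodType R) (p : dual_pairing a D) :
    dual_pairing (self_semidirect a) (D * D)%type :=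
  prod_pairing p p.

Section Coadjoint.
Context (R : realType).

(* [coad p xi mu] is the element nu of the dual with <nu, eta> = <mu, ad_xi eta>
   for all eta.  There is at most one by nondegeneracy; when there is none
   (which [has_coad p] excludes) the value is 0. *)
Definition coad (a : lieAlgType R) (D : lmodType R) (p : dual_pairing a D)
    (xi : a) (mu : D) : D :=
  xget 0 [set nu | forall eta, p nu eta = p mu (ad xi eta)].

Definition has_coad (a : lieAlgType R) (D : lmodType R)
    (p : dual_pairing a D) : Prop :=
  forall xi mu, exists nu, forall eta, p nu eta = p mu (ad xi eta).

Context (g : tvsLieAlgType R) (n : tvsType R) (sigma : lie_cocycle g n).
Context (gs ns : lmodType R) (pg : dual_pairing g gs) (pn : dual_pairing n ns).

Definition cocycle_dual (xi : g) (l : ns) : gs :=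
  xget 0 [set nu | forall eta, pg nu eta = pn l (sigma xi eta)].

Definition has_cocycle_dual : Prop :=
  forall xi l, exists nu, forall eta, pg nu eta = pn l (sigma xi eta).

End Coadjoint.

Section EulerPoincare.
Context (R : realType).

(* [derivable] and [is_derive] require a normed target, which would exclude
   Frechet spaces. *)
Definition is_curve_derive (V : tvsType R) (c : R -> V) (t : R) (v : V) : Prop :=
  (fun h : R => h^-1 *: (c (h + t) - c t)) @ 0^' --> v.

Definition differentiable_curve (V : tvsType R) (J : set R) (c : R -> V) : Prop :=
  forall t, J t -> exists v, is_curve_derive c t v.

(* mu = delta l / delta zeta *)
Definition is_functional_derivative (a D : lmodType R) (p : dual_pairing a D)
    (lagr : a -> R) (zeta : a) (mu : D) : Prop :=
  forall eta, is_derive (0 : R) 1 (fun e : R => lagr (zeta + e *: eta))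
    (p mu eta).

Definition is_momentum (a D : lmodType R) (p : dual_pairing a D) (J : set R)
    (lagr : a -> R) (zeta : R -> a) (mu : R -> D) : Prop :=
  forall t, J t -> is_functional_derivative p lagr (zeta t) (mu t).

Definition euler_poincare (a : lieAlgType R) (D : tvsType R)
    (p : dual_pairing a D) (J : set R) (zeta : R -> a) (mu : R -> D) : Prop :=
  forall t, J t ->
    exists2 mu', is_curve_derive mu t mu' & mu' + coad p (zeta t) (mu t) = 0.

End EulerPoincare.

(* Main.v *)
Require Import Defs.
From HB Require Import structures.
From mathcomp Require Import all_boot all_order all_algebra.
From mathcomp Require Import all_classical all_reals all_analysis.

Set Implicit Arguments.
Unset Strict Implicit.
Unset Printing Implicit Defensive.

Import Order.TTheory GRing.Theory Num.Theory.
Import numFieldNormedType.Exports.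

Local Open Scope classical_set_scope.
Local Open Scope ring_scope.

(** By nondegeneracy a coadjoint value is determined by its pairings, so it
    suffices to check a candidate against every vector; for the semidirect
    product this uses
      [ad_(X+Y) (Z+W) - ad_X Z = ad_Y Z + ad_(X+Y) W].
    The Euler-Poincare equation prescribes the derivative of the momentum as
    [- ad^*_zeta mu], which may then be read componentwise; limits need not be
    unique for this. *)

Lemma coad_unique (R : realType) (a : lieAlgType R) (D : lmodType R)
    (p : dual_pairing a D) (xi : a) (mu nu : D) :
  (forall eta, p nu eta = p mu (ad xi eta)) -> coad p xi mu = nu.
Proof.
(* The default value of [xget] cannot occur, since [nu] lies in the defining set; otherwise the
   chosen [nu'] has the same pairings as [nu]. *)
move=> hnu; rewrite /coad; case: xgetP => [nu' _ hnu'|/(_ nu)]; last by [].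
apply/eqP; rewrite -subr_eq0; apply/eqP.
by apply: (pairing_nondegl (d := p)) => eta; rewrite linearBl /= hnu' hnu subrr.
Qed.

Lemma coadE (R : realType) (a : lieAlgType R) (D : lmodType R)
    (p : dual_pairing a D) (hp : has_coad p) (xi : a) (mu : D) (eta : a) :
  p (coad p xi mu) eta = p mu (ad xi eta).
Proof. by have [nu hnu] := hp xi mu; rewrite (coad_unique hnu). Qed.

Lemma cocycle_dualE (R : realType) (g : tvsLieAlgType R) (n : tvsType R)
    (sigma : lie_cocycle g n) (gs ns : lmodType R)
    (pg : dual_pairing g gs) (pn : dual_pairing n ns)
    (h : has_cocycle_dual sigma pg pn) (xi : g) (l : ns) (eta : g) :
  pg (cocycle_dual sigma pg pn xi l) eta = pn l (sigma xi eta).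
Proof.
rewrite /cocycle_dual; case: xgetP => [nu _ hnu|nuP]; first exact: hnu.
by have [nu hnu] := h xi l; case: (nuP nu).
Qed.

(** The bracket with [x] ignores the central part of [eta], so the dual central component vanishes;
    what pairs with [eta.1] collects an [ad] term and a [sigma] term. *)
Lemma central_coadP (R : realType) (g : tvsLieAlgType R) (n : tvsType R)
    (sigma : lie_cocycle g n) (gs ns : lmodType R)
    (pg : dual_pairing g gs) (pn : dual_pairing n ns)
    (hg : has_coad pg) (hs : has_cocycle_dual sigma pg pn)
    (x : central_ext sigma) (mu : gs * ns) (eta : central_ext sigma) :
  central_pairing sigma pg pn
    (coad pg x.1 mu.1 + cocycle_dual sigma pg pn x.1 mu.2, 0) eta =
  central_pairing sigma pg pn mu (ad x eta).
Proof.
rewrite /= /prod_pairing_fun /= linear0l addr0 linearDl /=.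
by rewrite coadE // cocycle_dualE.
Qed.

(** The first dual slot collects the terms in [eta.1], namely [ad x.1] paired with [mu.1] and
    [ad x.2] paired with [mu.2]; the second slot collects the single term in [eta.2]. *)
Lemma semidirect_coadP (R : realType) (a : tvsLieAlgType R) (D : lmodType R)
    (p : dual_pairing a D) (hp : has_coad p)
    (x : self_semidirect a) (mu : D * D) (eta : self_semidirect a) :
  semidirect_pairing p
    (coad p x.1 mu.1 + coad p x.2 mu.2, coad p (x.1 + x.2) mu.2) eta =
  semidirect_pairing p mu (ad x eta).
Proof.
have adE : ad (x.1 + x.2) (eta.1 + eta.2) - ad x.1 eta.1 =
    ad x.2 eta.1 + ad (x.1 + x.2) eta.2.
  by apply/eqP; rewrite subr_eq adDr (adDl x.1 x.2 eta.1) -addrA addrC.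
rewrite /= /prod_pairing_fun /= adE linearDl /= !coadE //.
by rewrite linearDr addrA.
Qed.

(** Difference quotients in a product are formed componentwise, and neighbourhoods of [(v, w)] form
    the product filter. *)
Lemma is_curve_derive_pair (R : realType) (V W : tvsType R) (c : R -> V)
    (d : R -> W) (t : R) (v : V) (w : W) :
  is_curve_derive (fun s => (c s, d s)) t (v, w) <->
  is_curve_derive c t v /\ is_curve_derive d t w.
Proof.
rewrite /is_curve_derive; split=> [h|[hc hd]]; last exact: (cvg_pair hc hd).
split.
- exact: (cvg_comp _ _ h (@cvg_fst _ _ (nbhs v) (nbhs w) _)).
- exact: (cvg_comp _ _ h (@cvg_snd _ _ (nbhs v) (nbhs w) _)).
Qed.

Lemma euler_poincareP (R : realType) (a : lieAlgType R) (D : tvsType R)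
    (p : dual_pairing a D) (J : set R) (zeta : R -> a) (mu : R -> D) :
  euler_poincare p J zeta mu <->
  forall t, J t -> is_curve_derive mu t (- coad p (zeta t) (mu t)).
Proof.
split=> h t Jt; last first.
  by exists (- coad p (zeta t) (mu t)); [exact: h|rewrite addNr].
by have [mu' hmu' /eqP] := h t Jt; rewrite addr_eq0 => /eqP <-.
Qed.

Theorem mainTheorem2 (R : realType) (g : tvsLieAlgType R) (n : tvsType R)
    (sigma : lie_cocycle g n)
    (gs ns : tvsType R) (pg : dual_pairing g gs) (pn : dual_pairing n ns)
    (adstar_exists : has_coad pg)
    (sigmastar_exists : has_cocycle_dual sigma pg pn) :
  let adstar := coad pg in
  let sigmastar := cocycle_dual sigma pg pn in
  let P := semidirect_pairing (central_pairing sigma pg pn) in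
  [/\ has_coad P,
    (forall (xi_h xi_k : g) (alpha beta : n) (m nu : gs) (l o : ns),
      coad P ((xi_h, alpha), (xi_k, beta)) ((m, l), (nu, o)) =
        ((adstar xi_h m + sigmastar xi_h l + adstar xi_k nu + sigmastar xi_k o,
          0),
         (adstar (xi_h + xi_k) nu + sigmastar (xi_h + xi_k) o, 0))) &
    (forall (J : set R) (lagr : self_semidirect (central_ext sigma) -> R)
        (xi_h xi_k : R -> g) (alpha beta : R -> n)
        (m nu : R -> gs) (l o : R -> ns),
      let zeta : R -> self_semidirect (central_ext sigma) :=
        fun t => ((xi_h t, alpha t), (xi_k t, beta t)) in
      let mu : R -> (gs * ns) * (gs * ns) :=
        fun t => ((m t, l t), (nu t, o t)) in
      open J -> is_interval J ->
      differentiable_curve J zeta ->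
      is_momentum P J lagr zeta mu ->
      (euler_poincare P J zeta mu <->
       forall t, J t ->
         [/\ is_curve_derive m t
               (- adstar (xi_h t) (m t) - sigmastar (xi_h t) (l t)
                - adstar (xi_k t) (nu t) - sigmastar (xi_k t) (o t)),
             is_curve_derive l t 0,
             is_curve_derive nu t
               (- adstar (xi_h t + xi_k t) (nu t)
                - sigmastar (xi_h t + xi_k t) (o t)) &
             is_curve_derive o t 0]))].
Proof.
move=> adstar sigmastar P.
(* Existence climbs from [g] to the extension and then to the semidirect product; unification reads
   each witness off the explicit formula. *)
have hc : has_coad (central_pairing sigma pg pn).
  by move=> x mu; eexists; apply: central_coadP.
have hP : has_coad P by move=> x mu; eexists; apply: semidirect_coadP.
have coadPE (xi_h xi_k : g) (alpha beta : n) (m nu : gs) (l o : ns) :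
    coad P ((xi_h, alpha), (xi_k, beta)) ((m, l), (nu, o)) =
      ((adstar xi_h m + sigmastar xi_h l + adstar xi_k nu + sigmastar xi_k o,
        0),
       (adstar (xi_h + xi_k) nu + sigmastar (xi_h + xi_k) o, 0)).
  (* The outer semidirect layer is peeled off first, leaving coadjoint values on the central
     extension, which the next rewrite expands. *)
  rewrite (coad_unique (semidirect_coadP hc _ _)) /=.
  rewrite !(coad_unique (central_coadP adstar_exists sigmastar_exists _ _)) /=.
  by apply: prod_ext; apply: prod_ext; rewrite /= ?addr0 ?addrA.
split=> // J lagr xi_h xi_k alpha beta m nu l o zeta mu _ _ _ _.
rewrite euler_poincareP; split=> h t Jt; have := h t Jt;
  rewrite /zeta /mu coadPE.
(* The momentum is a pair of pairs, so the derivative is split at two levels; negating the zero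
   central components gives the conservation of [l] and [o]. *)
- move=> /is_curve_derive_pair[/is_curve_derive_pair[hm hl]].
  move=> /is_curve_derive_pair[hnu ho].
  by move: hm hl hnu ho; rewrite !opprD oppr0.
- move=> [hm hl hnu ho].
  apply/is_curve_derive_pair; split; apply/is_curve_derive_pair;
  by rewrite !opprD oppr0.
Qed.
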